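(* Let $A,B,C\in\mathbb{C}^{N\times N}$ be pairwise commuting matrices such that $B+sI$ and $C+sI$ are invertible for every integer $s\ge 0$. Then $${}_1F_2(A;B,C;z)=\sum_{s=0}^{\infty}\frac{z^s}{s!}(A)_s[(B)_s]^{-1}[(C)_s]^{-1}$$ is an entire ($\mathbb{C}^{N\times N}$-valued) function of $z$, i.e. the power series has infinite radius of convergence.
   Context: $I$ is the $N\times N$ identity matrix. For $M\in\mathbb{C}^{N\times N}$, $(M)_0=I$ and $(M)_s=M(M+I)\cdots(M+(s-1)I)$ for $s\ge1$. *)

(* Defs.v *)
From mathcomp Require Import all_boot all_order all_algebra.
From mathcomp Require Import all_classical all_reals all_analysis.
From mathcomp Require Import complex.

Set Implicit Arguments.
Unset Strict Implicit.
Unset Printing Implicit Defensive.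

Import Order.TTheory GRing.Theory Num.Theory.
Import numFieldNormedType.Exports.

Local Open Scope classical_set_scope.
Local Open Scope ring_scope.

Section MatrixFunctions.
Variables (K : numFieldType) (N : nat).
Implicit Types (M A B C : 'M[K]_N) (a : nat -> 'M[K]_N) (z : K).

Definition pochhammer_mx M (s : nat) : 'M[K]_N :=
  \prod_(k < s) (M + k%:R%:M).

Definition power_series_mx a z : nat -> 'M[K]_N :=
  [series z ^+ s *: a s]_s.

(* Coefficient of [z ^+ s]. *)
Definition hyp1F2_coef A B C (s : nat) : 'M[K]_N :=
  s`!%:R^-1 *: (pochhammer_mx A s *m invmx (pochhammer_mx B s)
                                  *m invmx (pochhammer_mx C s)).

(* [limn] is a junk value when the series diverges, so this is the sum of the
   series only where [power_series_mx (hyp1F2_coef A B C) z] converges. *)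
Definition hyp1F2 A B C z : 'M[K]_N :=
  limn (power_series_mx (hyp1F2_coef A B C) z).

(* The increment in [derivable] ranges over [K], so for [K] the complex numbers
   this is complex differentiability at every point. *)
Definition entire (F : K -> 'M[K]_N) : Prop := forall z, derivable F z 1.

End MatrixFunctions.

(* The norm of [z : R[i]] is itself an element of [R[i]] with zero imaginary
   part, hence the projection [complex.Re]. *)
Definition convergence_radius (R : realType) (N : nat)
    (a : nat -> 'M[R[i]]_N) : \bar R :=
  ereal_sup [set (complex.Re `|z|)%:E | z in
               [set z : R[i] | cvgn (power_series_mx a z)]].

(* Main.v *)
Require Import Defs.
From mathcomp Require Import all_boot all_order all_algebra.
From mathcomp Require Import all_classical all_reals all_analysis.
From mathcomp Require Import complex.
From mathcomp Require Import ring zify.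

Import Order.TTheory GRing.Theory Num.Theory.
Import numFieldNormedType.Exports.

Local Open Scope classical_set_scope.
Local Open Scope ring_scope.

(** The coefficient $a_s = (A)_s (B)_s^{-1} (C)_s^{-1} / s!$ is a product in
    which each [k < s] contributes the factors [A + k], [(B + k)^-1],
    [(C + k)^-1] and [1 / (k + 1)].  For the maximum norm, which is
    submultiplicative up to the factor [n], the norm of [a_s] is therefore at
    most [n ^ 2] times the product over [k < s] of the numbers
    [hyp1F2_ratio A B C k] ([hyp1F2_coef_le]).  Now [|A + k| / (k + 1)] stays
    bounded, while [|(M + k)^-1|] is [O(1 / k)], because [X (M + k) = 1] gives
    [k X = 1 - X M] ([mx_norm_inv_shift_le]).  So the ratios tend to [0] and
    [|a_s|] decays faster than every geometric sequence.

    Coefficients with this decay give an entire function.  Convergence is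
    comparison with a real geometric series ([dominated_series_cvg]).
    For complex differentiability, the difference quotient minus the series of
    termwise derivatives is again a series, with scalar weights
    [((z + h)^s - z^s) / h - s z^(s-1)].  These are at most
    [|h| (|z| + 1)^s] as soon as [|h| <= 1] ([norm_exprD_taylor1_le]), so that
    the difference is at most [|h|] times a convergent sum that does not depend
    on [h] ([small_coef_entire]).

    The norm of a complex matrix is an element of [R[i]] with zero imaginary
    part; the comparisons go through its real part. *)

(** * The maximum norm of matrices *)

Section MatrixNorm.
Context {K : numFieldType}.

Lemma normr_mxE {m n} (M : 'M[K]_(m, n)) : `|M| = mx_norm M.
Proof. by []. Qed.

Lemma mx_entry_le {m n} (M : 'M[K]_(m, n)) i j : `|M i j| <= `|M|.
Proof.
rewrite [leRHS]normr_mxE /mx_norm.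
rewrite -[leLHS]nngE num_le.
exact: (le_bigmax _ (fun p : 'I_m * 'I_n => `|M p.1 p.2|%:nng) (i, j)).
Qed.

Lemma mx_norm_le {m n} (M : 'M[K]_(m, n)) (e : K) :
  0 <= e -> (forall i j, `|M i j| <= e) -> `|M| <= e.
Proof.
move=> e0 Me; rewrite [leLHS]normr_mxE /mx_norm -[e]/((NngNum e0)%:num) num_le.
by apply/bigmax_leP; split => [|[i j] _]; rewrite -num_le//=; exact: Me.
Qed.

Lemma mx_norm_mul {n} (A B : 'M[K]_n) : `|A *m B| <= n%:R * `|A| * `|B|.
Proof.
apply: mx_norm_le => [|i j]; first by rewrite !mulr_ge0.
rewrite mxE (le_trans (ler_norm_sum _ _ _))//.
rewrite -mulrA mulr_natl -[X in _ *+ X]card_ord -sumr_const.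
apply: ler_sum => k _; rewrite normrM.
by apply: ler_pM => //; exact: mx_entry_le.
Qed.

Lemma mx_norm_scalar {n} (a : K) : `|a%:M : 'M[K]_n| <= `|a|.
Proof.
apply: mx_norm_le => // i j; rewrite mxE.
by case: eqP => //= _; rewrite mulr0n normr0.
Qed.

End MatrixNorm.

(** * Super-exponential decay of the coefficients *)

Section CoefficientBound.
Context {K : numFieldType} {n : nat}.
Implicit Types A B C M : 'M[K]_n.

Lemma pochhammer_mxS M s :
  pochhammer_mx M s.+1 = pochhammer_mx M s *m (M + s%:R%:M).
Proof. by rewrite /pochhammer_mx big_ord_recr. Qed.

Lemma pochhammer_mx_unit M s :
  (forall k, M + k%:R%:M \in unitmx) -> pochhammer_mx M s \in unitmx.
Proof.
move=> Mu; elim: s => [|s IH]; first by rewrite /pochhammer_mx big_ord0 unitmx1.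
by rewrite pochhammer_mxS unitmx_mul IH Mu.
Qed.

Lemma invmx_mul (P Q : 'M[K]_n) : P \in unitmx -> Q \in unitmx ->
  invmx (P *m Q) = invmx Q *m invmx P.
Proof.
move=> Pu Qu; apply: (can_inj (mulKmx (_ : P *m Q \in unitmx))).
  by rewrite unitmx_mul Pu.
by rewrite mulmxV ?unitmx_mul ?Pu// -mulmxA mulKVmx// mulmxV.
Qed.

Lemma mx_norm_pochhammer M s :
  `|pochhammer_mx M s| <= \prod_(k < s) (n%:R * `|M + k%:R%:M|).
Proof.
elim: s => [|s IH].
  rewrite /pochhammer_mx !big_ord0 -[leRHS](@normr1 K).
  exact: (@mx_norm_scalar K n 1).
rewrite pochhammer_mxS big_ord_recr/= (le_trans (mx_norm_mul _ _))//.
by rewrite mulrAC mulrC ler_wpM2r ?mulr_ge0.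
Qed.

Lemma mx_norm_inv_pochhammer M s : (forall k, M + k%:R%:M \in unitmx) ->
  `|invmx (pochhammer_mx M s)| <=
    \prod_(k < s) (n%:R * `|invmx (M + k%:R%:M)|).
Proof.
move=> Mu; elim: s => [|s IH].
  rewrite /pochhammer_mx !big_ord0 invmx1 -[leRHS](@normr1 K).
  exact: (@mx_norm_scalar K n 1).
rewrite pochhammer_mxS big_ord_recr/= invmx_mul ?pochhammer_mx_unit//.
by rewrite (le_trans (mx_norm_mul _ _))// mulrC ler_wpM2r ?mulr_ge0.
Qed.

(** A bound for what the index [k] contributes to a coefficient.  Each factor
    [n%:R] pays for one product of matrices: the one that appends the [k]-th
    factor to a Pochhammer matrix or to its inverse. *)
Definition hyp1F2_ratio A B C (k : nat) : K :=
  (n%:R * `|A + k%:R%:M|) * (n%:R * `|invmx (B + k%:R%:M)|)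
  * (n%:R * `|invmx (C + k%:R%:M)|) / k.+1%:R.

Lemma hyp1F2_ratio_ge0 A B C k : 0 <= hyp1F2_ratio A B C k.
Proof. by rewrite !mulr_ge0// invr_ge0. Qed.

(** The two products of Pochhammer matrices in the coefficient cost the factor
    [n ^ 2]; everything else distributes over the indices [k < s]. *)
Lemma hyp1F2_coef_le A B C s :
  (forall k, B + k%:R%:M \in unitmx) -> (forall k, C + k%:R%:M \in unitmx) ->
  `|hyp1F2_coef A B C s| <= n%:R ^+ 2 * \prod_(k < s) hyp1F2_ratio A B C k.
Proof.
move=> Bu Cu; rewrite /hyp1F2_coef mx_normZ normfV normr_nat.
have facE : (\prod_(i < s) i.+1 = s`!)%N by rewrite fact_prod big_add1 big_mkord.
rewrite /hyp1F2_ratio 3!big_split/= prodfV -natr_prod facE.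
rewrite mulrC [leRHS]mulrA ler_wpM2r ?invr_ge0//.
rewrite (le_trans (mx_norm_mul _ _))// expr2 -!(mulrA n%:R) ler_wpM2l//.
rewrite !mulrA; apply: ler_pM => //; last exact: mx_norm_inv_pochhammer.
rewrite (le_trans (mx_norm_mul _ _))// -!mulrA ler_wpM2l//.
by apply: ler_pM; rewrite // ?mx_norm_pochhammer ?mx_norm_inv_pochhammer.
Qed.

(** With [X] the inverse, [X (M + k) = 1] reads [k X = 1 - X M], whence
    [k |X| <= 1 + n |M| |X| <= 1 + b |X|]. *)
Lemma mx_norm_inv_shift_le {M} {b m k : nat} : M + k%:R%:M \in unitmx ->
  n%:R * `|M| <= b%:R -> (b + m <= k)%N -> m%:R * `|invmx (M + k%:R%:M)| <= 1.
Proof.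
move=> Mu Mb bmk; set X := invmx _.
have kX : k%:R *: X = 1%:M - X *m M.
  by rewrite -(mulVmx Mu) -/X mulmxDr addrC addKr mul_mx_scalar.
have kXle : k%:R * `|X| <= 1 + b%:R * `|X|.
  rewrite -{1}(@normr_nat K k) -mx_normZ kX (le_trans (ler_normB _ _))//.
  rewrite lerD//.
    by rewrite (le_trans (mx_norm_scalar _))// normr1.
  by rewrite (le_trans (mx_norm_mul _ _))// mulrAC ler_wpM2r.
rewrite -(lerD2r (b%:R * `|X|)) (le_trans _ kXle)// -mulrDl -natrD.
by rewrite ler_wpM2r// ler_nat addnC.
Qed.

(** A quantitative form of the convergence of the ratios to [0]: beyond the
    threshold, [m n ^ 3 (a + 1)] times the norm of the inverse of [B + k] is at
    most [1], the inverse of [C + k] has norm at most [1], and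
    [|A + k| / (k + 1)] is at most [a + 1]. *)
Lemma hyp1F2_ratio_le {A B C} {a b c m k : nat} :
  B + k%:R%:M \in unitmx -> C + k%:R%:M \in unitmx ->
  `|A| <= a%:R -> n%:R * `|B| <= b%:R -> n%:R * `|C| <= c%:R ->
  (b + c + (m * n ^ 3 * a.+1).+1 <= k)%N -> m%:R * hyp1F2_ratio A B C k <= 1.
Proof.
move=> Bu Cu Aa Bb Cc; set M := (m * n ^ 3 * a.+1)%N => Mk.
have XM : M%:R * `|invmx (B + k%:R%:M)| <= 1.
  by apply: (mx_norm_inv_shift_le Bu Bb); apply: leq_trans Mk; lia.
have Y1 : 1 * `|invmx (C + k%:R%:M)| <= 1.
  by apply: (@mx_norm_inv_shift_le _ _ 1%N _ Cu Cc); apply: leq_trans Mk; lia.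
have Ak : `|A + k%:R%:M| / k.+1%:R <= a.+1%:R.
  rewrite ler_pdivrMr// (le_trans (ler_normD _ _))//.
  rewrite (@le_trans _ _ (a%:R + k%:R))//.
    by rewrite lerD// (le_trans (mx_norm_scalar _))// normr_nat.
  by rewrite -natrD -natrM ler_nat; lia.
rewrite /hyp1F2_ratio.
set u := `|A + _|; set x := `|invmx (B + _)|; set y := `|invmx (C + _)|.
rewrite [leLHS](_ : _ = m%:R * n%:R ^+ 3 * (u / k.+1%:R) * x * y); last ring.
have Mx : m%:R * n%:R ^+ 3 * (u / k.+1%:R) * x <= 1.
  by apply: le_trans XM; rewrite ler_wpM2r ?normr_ge0//
     /M 2!natrM natrX ler_wpM2l//.
rewrite -[leRHS]mulr1; apply: ler_pM; rewrite ?normr_ge0//.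
  by rewrite !mulr_ge0 ?exprn_ge0 ?invr_ge0 ?normr_ge0.
by rewrite -[y]mul1r.
Qed.

(** From [n0] on, passing from [s] to [s + 1] multiplies the left-hand side by
    at most [1], so its values up to [n0] control it; their sum is a bound. *)
Lemma prod_geometric_bounded {q : nat -> K} {m n0 : nat} :
  (forall k, 0 <= q k) -> (forall k, (n0 <= k)%N -> m%:R * q k <= 1) ->
  exists2 c : K, 0 <= c & forall s, m%:R ^+ s * \prod_(k < s) q k <= c.
Proof.
move=> q0 mq; pose x s := m%:R ^+ s * \prod_(k < s) q k.
have x0 s : 0 <= x s by rewrite mulr_ge0 ?exprn_ge0 ?prodr_ge0.
exists (\sum_(s < n0.+1) x s) => [|s]; first exact: sumr_ge0.
have xle s' : (s' <= n0)%N -> x s' <= \sum_(s < n0.+1) x s.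
  move=> s'n; rewrite (bigD1 (Ordinal (s'n : s' < n0.+1)%N))//= lerDl.
  exact: sumr_ge0.
rewrite -/(x s); have [/xle//|/ltnW] := leqP s n0.
elim: s => [|s IH]; first by move=> _; exact: xle.
rewrite leq_eqVlt => /predU1P[<-|]; first exact: xle.
rewrite ltnS => n0s; apply: le_trans (IH n0s).
rewrite /x exprSr big_ord_recr/= mulrACA [leLHS](_ : _ = x s * (m%:R * q s)).
  by rewrite -[leRHS]mulr1 ler_wpM2l ?mq.
by [].
Qed.

End CoefficientBound.

(** * Scalar estimates and limits *)

Lemma limn_norm_le {K : numFieldType} {V : normedModType K} {u : V ^nat} {c : K} :
  cvgn u -> (forall n, `|u n| <= c) -> `|limn u| <= c.
Proof.
move=> /cvg_ex[l ul] uc; rewrite (cvg_lim (@norm_hausdorff _ _) ul).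
apply/ler_addgt0Pr => e e0.
move/cvgrPdist_le : ul => /(_ e e0) ul.
near \oo => n.
rewrite -(subrK (u n) l) (le_trans (ler_normD _ _))// addrC lerD//.
by near: n.
Unshelve. all: by end_near. Qed.

(** The polynomial factor [s] that the mean value inequality would give is
    absorbed by enlarging the base from [|z|] to [|z| + 1], which keeps the
    induction free of binomial coefficients. *)
Lemma norm_exprD_sub_le {K : numFieldType} {z h : K} (s : nat) : `|h| <= 1 ->
  `|(h + z) ^+ s - z ^+ s| <= `|h| * (`|z| + 1) ^+ s.
Proof.
move=> h1; elim: s => [|s IH]; first by rewrite !expr0 subrr normr0 mulr1.
rewrite [X in `|X|](_ : _ = z * ((h + z) ^+ s - z ^+ s) + h * (h + z) ^+ s);
  last by rewrite !exprS; ring.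
rewrite (le_trans (ler_normD _ _))// exprS mulrCA [leRHS]mulrDl mul1r.
rewrite !normrM lerD ?ler_wpM2l// normrX lerXn2r ?nnegrE ?addr_ge0//.
by rewrite (le_trans (ler_normD _ _))// addrC lerD.
Qed.

Lemma norm_exprD_taylor1_le {K : numFieldType} {z h : K} (s : nat) : `|h| <= 1 ->
  `|(h + z) ^+ s - z ^+ s - h * (s%:R * z ^+ s.-1)|
    <= `|h| ^+ 2 * (`|z| + 1) ^+ s.
Proof.
move=> h1; elim: s => [|s IH].
  by rewrite !expr0 subrr mul0r mulr0 subr0 normr0 mulr1 exprn_ge0.
rewrite [X in `|X|](_ : _ = z * ((h + z) ^+ s - z ^+ s - h * (s%:R * z ^+ s.-1))
   + h * ((h + z) ^+ s - z ^+ s)); last first.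
  rewrite -pred_Sn; case: s {IH} => [|s].
    by rewrite !expr0 !expr1; ring.
  by rewrite -pred_Sn -!natr1 !exprS; ring.
rewrite (le_trans (ler_normD _ _))// (exprS (`|z| + 1)) [leRHS]mulrCA [leRHS]mulrDl mul1r.
by rewrite !normrM lerD ?ler_wpM2l// expr2 -mulrA ler_wpM2l// norm_exprD_sub_le.
Qed.

Lemma norm_exprn_deriv_le {K : numFieldType} {z : K} (s : nat) :
  `|s%:R * z ^+ s.-1| <= (`|z| + 1) ^+ s.
Proof.
elim: s => [|s IH]; first by rewrite mul0r normr0 expr0.
have -> : s.+1%:R * z ^+ s = z * (s%:R * z ^+ s.-1) + z ^+ s.
  by case: s {IH} => [|s]; rewrite -?natr1 ?exprS /=; ring.
rewrite (le_trans (ler_normD _ _))// exprS mulrDl mul1r normrM lerD ?ler_wpM2l//.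
by rewrite normrX lerXn2r ?nnegrE ?addr_ge0// lerDl.
Qed.

(** * Absolute convergence of series of complex matrices *)

Section ComplexSeries.
Local Open Scope complex_scope.
Context {R : realType} {N : nat}.
(* The cast makes the topology of a numeric field available on [R[i]]. *)
Local Notation C := (R[i] : numFieldType).

Lemma ge0_complexE {x : R[i]} : 0 <= x -> x = (complex.Re x)%:C.
Proof. by move=> /ger0_real /RRe_real. Qed.

Lemma norm_complexE {V : normedZmodType C} (x : V) :
  exists2 k : R, 0 <= k & `|x| = k%:C.
Proof.
exists (complex.Re `|x|); last exact: ge0_complexE.
by rewrite -ler0c -ge0_complexE.
Qed.

Lemma norm_le_ReIm (x : R[i]) : `|x| <= (`|complex.Re x| + `|complex.Im x|)%:C.
Proof.
have normC (r : R) : `|r%:C| = `|r|%:C.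
  by rewrite normc_def /= expr0n addr0 sqrtr_sqr.
rewrite {1}[x]complexE (le_trans (ler_normD _ _))// normrM complexiE normCi mul1r.
by rewrite !normC rmorphD.
Qed.

Lemma complex_archi {x : R[i]} : 0 <= x -> exists n : nat, x <= n%:R.
Proof.
move=> x0; have rx0 : 0 <= complex.Re x by rewrite -ler0c -ge0_complexE.
exists (Num.bound (complex.Re x)); rewrite (ge0_complexE x0).
rewrite -(rmorph_nat (real_complex R)) lecR.
by have /ltW := archi_boundP rx0.
Qed.

(** Each entry has real and imaginary parts that are absolutely convergent real
    series, so the completeness of [R] provides the limit entry by entry. *)
Lemma dominated_series_cvg {u : nat -> 'M[C]_N} {b : R ^nat} :
  (forall n, `|u n| <= (b n)%:C) -> cvgn (series b) -> cvgn (series u).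
Proof.
move=> ub cb.
have b0 n : 0 <= b n by rewrite -ler0c (le_trans _ (ub n)).
have abs_le n i j : `|u n i j| <= (b n)%:C.
  by rewrite (le_trans (mx_entry_le _ _ _)).
pose x i j : R ^nat := fun n => complex.Re (u n i j).
pose y i j : R ^nat := fun n => complex.Im (u n i j).
have cx i j : cvgn (series (x i j)).
  apply: normed_cvg; apply: (series_le_cvg _ _ _ cb) => //= n.
  by rewrite -lecR (le_trans (normc_ge_Re _)).
have cy i j : cvgn (series (y i j)).
  apply: normed_cvg; apply: (series_le_cvg _ _ _ cb) => //= n.
  rewrite -lecR (le_trans _ (abs_le n i j))// /y -normrN -ReiNIm.
  by rewrite (le_trans (normc_ge_Re _))// normrM complexiE normCi mulr1.
have uE n i j : series u n i j = (series (x i j) n) +i* (series (y i j) n).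
  elim: n => [|n IH]; first by rewrite !seriesEord/= !big_ord0 mxE.
  by rewrite !seriesSr mxE IH /x /y; apply/eqP; rewrite eq_complex;
    move: (u n i j) => [p q] /=; rewrite !eqxx.
apply/cvg_ex.
exists (\matrix_(i, j) (limn (series (x i j)) +i* limn (series (y i j)))).
apply/cvgrPdist_le => e e0.
have [eE e0'] : e = (complex.Re e)%:C /\ 0 < complex.Re e.
  split; first by rewrite -ge0_complexE ?ltW.
  by rewrite -ltcR -ge0_complexE ?ltW.
have e2 : 0 < complex.Re e / 2 by rewrite divr_gt0.
near=> n.
apply: mx_norm_le => [|i j]; first exact: ltW.
rewrite !mxE uE (le_trans (norm_le_ReIm _))// eE lecR /= [leRHS]splitr lerD//.
- move: i j; near: n.
  apply: filter_forall => i; apply: filter_forall => j.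
  exact: (cvgrPdist_le _ _).1 (cx i j) _ e2.
- move: i j; near: n.
  apply: filter_forall => i; apply: filter_forall => j.
  exact: (cvgrPdist_le _ _).1 (cy i j) _ e2.
Unshelve. all: by end_near. Qed.

End ComplexSeries.

(** * Power series with super-exponentially small coefficients *)

Section EntireSeries.
Local Open Scope complex_scope.
Context {R : realType} {N : nat}.
Local Notation C := (R[i] : numFieldType).
Context {a : nat -> 'M[C]_N}.
(* By the Archimedean property, integer rates [m] cover all real ones. *)
Context (a_small : forall m : nat,
  exists2 c : C, 0 <= c & forall s, m%:R ^+ s * `|a s| <= c).

Lemma small_coef_series_cvg {r : R} : 0 <= r ->
  cvgn (series (fun s => complex.Re `|a s| * r ^+ s)).
Proof.
move=> r0; pose m := (Num.bound r).*2.
have m0 : (0 < m)%N.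
  by rewrite double_gt0 -(ltr_nat R) (le_lt_trans r0)// archi_boundP.
(* As [m >= 2 r], decay at rate [m] leaves a ratio at most [1 / 2]. *)
have rm : r / m%:R <= 2^-1.
  rewrite ler_pdivrMr ?ltr0n// /m -muln2 natrM mulrCA mulVf ?mulr1 ?pnatr_eq0//.
  exact/ltW/archi_boundP.
have [c c0 ac] := a_small m.
have g : cvgn (series (geometric (complex.Re c) (2^-1 : R))).
  apply: is_cvg_geometric_series.
  by rewrite ger0_norm ?invr_ge0// invf_lt1// ltr1n.
have a0 s : 0 <= complex.Re `|a s| by rewrite -ler0c -ge0_complexE.
apply: (series_le_cvg _ _ _ g) => s /=.
- by rewrite mulr_ge0 ?exprn_ge0.
- by rewrite mulr_ge0 ?exprn_ge0 ?invr_ge0// -ler0c -ge0_complexE.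
have {}ac : m%:R ^+ s * complex.Re `|a s| <= complex.Re c.
  by rewrite -lecR rmorphM rmorphXn rmorph_nat/= -!ge0_complexE//.
have -> : r ^+ s = m%:R ^+ s * (r / m%:R) ^+ s.
  by rewrite -exprMn mulrCA divff ?mulr1// pnatr_eq0 -lt0n.
rewrite mulrA [X in X * _]mulrC; apply: ler_pM => //.
- by rewrite mulr_ge0 ?exprn_ge0.
- by rewrite exprn_ge0// divr_ge0.
- by apply: lerXn2r; rewrite ?nnegrE ?divr_ge0// invr_ge0.
Qed.

(** Used with the weights [z ^+ s], with those of the termwise derivative, and
    with the error of the difference quotient; in the last case [k] is the norm
    of the increment, which is why it is kept apart from [r]. *)
Lemma small_coef_weighted {w : nat -> C} {k r : R} : 0 <= k -> 0 <= r ->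
  (forall s, `|w s| <= (k * r ^+ s)%:C) ->
  cvgn (series (fun s => w s *: a s)) /\
  `|limn (series (fun s => w s *: a s))| <=
    (k * limn (series (fun s => complex.Re `|a s| * r ^+ s)))%:C.
Proof.
move=> k0 r0 wr; have ca := small_coef_series_cvg r0.
set b := fun s => complex.Re `|a s| * r ^+ s in ca *.
have wb s : `|w s *: a s| <= ((k *: b) s)%:C.
  have -> : (k *: b) s = k * r ^+ s * complex.Re `|a s|.
    by rewrite /b -mulrA [_ ^+ s * _]mulrC.
  by rewrite mx_normZ rmorphM/= -ge0_complexE// ler_wpM2r.
have cb : cvgn (series (k *: b)) by exact: is_cvg_seriesZ.
have cw := dominated_series_cvg wb cb.
split => //; apply: limn_norm_le => // n.
have b0 s : 0 <= (k *: b) s by rewrite -ler0c (le_trans _ (wb s)).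
rewrite -[k * _](lim_seriesZ k ca).
have /(_ n) : forall n, series (k *: b) n <= limn (series (k *: b)).
  by apply: nondecreasing_cvgn_le => //; apply: nondecreasing_series => s _ _.
rewrite -lecR; apply: le_trans.
rewrite /series/= rmorph_sum (le_trans (ler_norm_sum _ _ _))//.
exact: ler_sum.
Qed.

Lemma small_coef_power_series_cvg (z : C) : cvgn (power_series_mx a z).
Proof.
have [k k0 zE] := norm_complexE z.
have [s|] // := small_coef_weighted (w := fun s => z ^+ s) ler01 k0.
by rewrite mul1r normrX zE rmorphXn.
Qed.

Lemma small_coef_radius : convergence_radius a = +oo%E.
Proof.
apply/eqyP => r r0; apply: ereal_sup_ubound; exists (r%:C).
  exact: small_coef_power_series_cvg.
by rewrite ger0_norm// ler0c ltW.
Qed.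

(** The derivative is the termwise one, [G], and the difference quotient at
    increment [h] is within [`|h| * S%:C] of it. *)
Lemma small_coef_entire : entire (fun z => limn (power_series_mx a z)).
Proof.
move=> z; have [k k0 zE] := norm_complexE z; pose rho := k + 1.
have rhoE : rho%:C = `|z| + 1 by rewrite rmorphD zE.
have rho0 : 0 <= rho by rewrite addr_ge0.
pose dw s : C := s%:R * z ^+ s.-1.
pose S := limn (series (fun s => complex.Re `|a s| * rho ^+ s)).
have [s|cd _] := small_coef_weighted (w := dw) ler01 rho0.
  by rewrite mul1r rmorphXn/= rhoE; exact: norm_exprn_deriv_le.
pose G := limn (series (fun s => dw s *: a s)).
have quot_le (h : C) : h != 0 -> `|h| <= 1 ->
    `|G - h^-1 *: (limn (power_series_mx a (h + z)) -
                   limn (power_series_mx a z))| <= `|h| * S%:C.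
  move=> h0 h1.
  pose w s : C := dw s - h^-1 * ((h + z) ^+ s - z ^+ s).
  have [l l0 hE] := norm_complexE h.
  have wle s : `|w s| <= (l * rho ^+ s)%:C.
    rewrite rmorphM rmorphXn/= rhoE -hE.
    rewrite -(ler_pM2l (_ : 0 < `|h|)) ?normr_gt0// mulrA -expr2 -normrM.
    rewrite -normrN [X in `|X|](_ : _ = (h + z) ^+ s - z ^+ s - h * dw s).
      exact: norm_exprD_taylor1_le.
    by rewrite /w mulrBr mulVKf// opprB.
  have [_] := small_coef_weighted l0 rho0 wle.
  rewrite rmorphM/= -hE; congr (`|_| <= _).
  apply: cvg_lim; first exact: norm_hausdorff.
  have -> : series (fun s => w s *: a s) =
      series (fun s => dw s *: a s) -
      h^-1 \*: (power_series_mx a (h + z) - power_series_mx a z).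
    apply/funext => n.
    rewrite !fctE /power_series_mx /series/= -sumrB scaler_sumr -sumrB.
    by apply: eq_bigr => s _; rewrite -scalerBl scalerA -scalerBl.
  have cp := small_coef_power_series_cvg.
  exact: (cvgB cd (cvgZl_tmp (cvgB (cp (h + z)) (cp z)))).
apply/cvg_ex; exists G; apply/cvgrPdist_le => e e0.
(* The nonnegativity of [S] is read off the estimate at [h = 1]. *)
have S0 : 0 <= S%:C.
  have := quot_le 1 (oner_neq0 _); rewrite normr1 mul1r => /(_ (lexx _)).
  exact: le_trans.
near=> h.
rewrite /shift /= [h *: _]mulr1.
have h0 : h != 0 by near: h; exact: nbhs_dnbhs_neq.
rewrite (le_trans (quot_le h h0 _))//.
  by apply/ltW; near: h; exact: dnbhs0_lt.
rewrite (@le_trans _ _ (`|h| * (S%:C + 1)))//; first by rewrite ler_wpM2l// lerDl.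
rewrite -ler_pdivlMr ?ltr_wpDl//; apply/ltW; near: h; apply: dnbhs0_lt.
by rewrite divr_gt0// ltr_wpDl.
Unshelve. all: by end_near. Qed.

End EntireSeries.

(** * The hypergeometric series *)

Theorem theorem2p1 (R : realType) (N : nat) (A B C : 'M[R[i]]_N)
    (commAB : comm_mx A B) (commAC : comm_mx A C) (commBC : comm_mx B C)
    (unitB : forall s : nat, B + s%:R%:M \in unitmx)
    (unitC : forall s : nat, C + s%:R%:M \in unitmx) :
  [/\ convergence_radius (hyp1F2_coef A B C) = +oo%E,
      forall z : R[i], cvgn (power_series_mx (hyp1F2_coef A B C) z)
    & entire (hyp1F2 A B C)].
Proof.
have small (m : nat) : exists2 c : R[i], 0 <= c &
    forall s, m%:R ^+ s * `|hyp1F2_coef A B C s| <= c.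
  have [a Aa] := complex_archi (normr_ge0 A).
  have [b Bb] := complex_archi (mulr_ge0 (ler0n _ N) (normr_ge0 B)).
  have [c Cc] := complex_archi (mulr_ge0 (ler0n _ N) (normr_ge0 C)).
  have [d d0 dP] := prod_geometric_bounded (hyp1F2_ratio_ge0 A B C)
    (fun k => hyp1F2_ratio_le (m := m) (unitB k) (unitC k) Aa Bb Cc).
  exists (N%:R ^+ 2 * d) => [|s]; first by rewrite mulr_ge0 ?exprn_ge0.
  apply: (@le_trans _ _
    (m%:R ^+ s * (N%:R ^+ 2 * \prod_(k < s) hyp1F2_ratio A B C k))).
    by rewrite ler_wpM2l ?exprn_ge0 ?hyp1F2_coef_le.
  by rewrite mulrCA ler_wpM2l ?exprn_ge0.
split.
- exact: small_coef_radius small.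
- exact: small_coef_power_series_cvg small.
- exact: small_coef_entire small.
Qed.
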